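(* Let $n\ge 2$, let $K=K(t,x,u,u_1,\dots,u_n)$ be smooth with $\partial K/\partial u_n$ nowhere zero, and let $\Delta=u_t-K$. Let $[\omega]\in H^{1,2}(\mathcal R^\infty)$ with a representative of the form $$\omega=dx\wedge\theta^0\wedge d_VQ-dt\wedge d_V\gamma=d_V\eta,\qquad \eta=dx\wedge\theta^0\cdot Q-dt\wedge\gamma,$$ where $Q\in C^\infty(\mathcal R^\infty)$ and $\gamma\in\Omega^{0,1}(\mathcal R^\infty)$. Let $\lambda=L\,dt\wedge dx\in\Omega^{2,0}(\mathcal R^\infty)$ satisfy $d_H\eta=d_V\lambda$. Then $\mathcal E=\mathbf F_Q^*-\mathbf F_Q$ is a variational operator for $\Delta$, and $$\mathcal E(\Delta)=(\mathbf F_Q^*-\mathbf F_Q)(\Delta)=\mathbf E(Q\Delta+L).$$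
   Context: Write $u_0=u$, $u_i=\partial_x^i u$; smooth functions depend on finitely many coordinates. $\mathcal R^\infty$ is the infinitely prolonged equation manifold of $\Delta=0$, with coordinates $(t,x,u,u_1,u_2,\dots)$. On it $X=\partial_x+\sum_i u_{i+1}\partial_{u_i}$, $T=\partial_t+\sum_i X^i(K)\partial_{u_i}$, $\theta^i=du_i-X^i(K)\,dt-u_{i+1}\,dx$. $\Omega^{r,s}(\mathcal R^\infty)$ is the space of forms that are finite sums of a function times $r$ of the forms $dt,dx$ wedged with $s$ of the $\theta^i$. $X,T$ act on forms by Lie derivative (they annihilate $dt,dx$; $X(\theta^i)=\theta^{i+1}$). $d_H\omega=dx\wedge X(\omega)+dt\wedge T(\omega)$, $d_V=d-d_H$, $H^{r,s}(\mathcal R^\infty)=\ker(d_H|_{\Omega^{r,s}})/d_H(\Omega^{r-1,s})$. Functions of $(t,x,u,u_1,\dots)$ on $\mathcal R^\infty$ (in particular $Q$ and $L$) are also regarded as functions on $J^\infty(\mathbb R^2,\mathbb R)$, which has coordinates $(t,x,u_{a,i})_{a,i\ge0}$ ($u_{a,i}$ corresponding to $\partial_t^a\partial_x^iu$, $u_{0,i}=u_i$, $u_{1,0}=u_t$), total derivatives $D_t,D_x$, and Euler operator $\mathbf E(L)=\sum_{a,i}(-1)^{a+i}D_x^iD_t^a(\partial L/\partial u_{a,i})$. The displayed identity holds on $J^\infty(\mathbb R^2,\mathbb R)$. $\mathbf F_Q=\sum_i(\partial Q/\partial u_i)D_x^i$ and $\mathbf F_Q^*(f)=\sum_i(-D_x)^i((\partial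 Q/\partial u_i)f)$. An operator $\mathcal E=\sum_i r_i(t,x,u,u_1,\dots)D_x^i$ is a variational operator for $\Delta$ if $\mathcal E(\Delta)=\mathbf E(L')$ for some $L'\in C^\infty(J^\infty(\mathbb R^2,\mathbb R))$ (the zero operator being allowed). *)

(* Defs.v *)
From HB Require Import structures.
From mathcomp Require Import all_boot all_order all_algebra.
From mathcomp Require Import all_classical all_reals all_analysis.

Set Implicit Arguments.
Unset Strict Implicit.
Unset Printing Implicit Defensive.

Import Order.TTheory GRing.Theory Num.Theory.
Import numFieldNormedType.Exports.

Local Open Scope classical_set_scope.
Local Open Scope ring_scope.

(* Points are families of coordinates indexed by C.  Functions form a ring
   for the pointwise operations. *)
Notation fn R C := ((C -> R) -> R).

Section SmoothFunctions.
Context {R : realType} {C : choiceType}.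
Local Notation fn := (fn R C).

Definition coordfn (a : C) : fn := fun z => z a.

Definition slice (a : C) (f : fn) (z : C -> R) : R -> R :=
  fun s => f [eta z with a |-> s].

Definition partial (a : C) (f : fn) : fn := fun z => derive1 (slice a f z) (z a).

(* Finitely many coordinates, and all iterated partial derivatives exist and
   are continuous; for a function of finitely many coordinates, continuity for
   the product topology is continuity in these coordinates. *)
Definition smooth (f : fn) : Prop :=
  (exists s : seq C, forall z z' : C -> R, {in s, z =1 z'} -> f z = f z') /\
  forall l : seq C,
    (forall (a : C) (z : C -> R), derivable (slice a (foldr partial f l) z) (z a) 1) /\
    continuous (foldr partial f l : prod_topology (fun _ : C => R) -> R).

(* A vector field is given by its components V a = V(z_a).  The sums
   \sum_(a \in setT) are sums with finite support, which is the case here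
   because f depends on finitely many coordinates. *)
Definition vfield_act (V : C -> fn) (f : fn) : fn :=
  \sum_(a \in [set: C]) V a * partial a f.

End SmoothFunctions.

(* Independent variables: inl true is t and inl false is x; the right summand
   indexes the derivatives of u. *)
Notation eqcoord := (bool + nat)%type.
Notation jetcoord := (bool + nat * nat)%type.

(* A k-form is given by the alternating family of its values on k-tuples of
   coordinate vector fields, with (a /\ b)(v, w) = a(v) b(w) - a(w) b(v);
   one-forms used as left factors are given by their components.  Alternation
   holds for the elements of Omega below. *)
Notation dform R := (seq eqcoord -> fn R eqcoord).
Notation covector R := (eqcoord -> fn R eqcoord).

Section EquationManifold.
Context {R : realType}.

Definition ct : eqcoord := inl true.
Definition cx : eqcoord := inl false.
Definition cu (i : nat) : eqcoord := inr i.

Definition order_le (n : nat) (f : fn R eqcoord) : Prop :=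
  forall z z' : eqcoord -> R, z ct = z' ct -> z cx = z' cx ->
    (forall i, (i <= n)%N -> z (cu i) = z' (cu i)) -> f z = f z'.

Definition Xfield (a : eqcoord) : fn R eqcoord :=
  match a with
  | inl b => (~~ b)%:R
  | inr i => coordfn (cu i.+1)
  end.

Definition X : fn R eqcoord -> fn R eqcoord := vfield_act Xfield.

Definition Tfield (K : fn R eqcoord) (a : eqcoord) : fn R eqcoord :=
  match a with
  | inl b => b%:R
  | inr i => iter i X K
  end.

Definition T (K : fn R eqcoord) : fn R eqcoord -> fn R eqcoord :=
  vfield_act (Tfield K).

Definition zeroform (f : fn R eqcoord) : dform R :=
  fun l => if l is [::] then f else 0.

Definition del (j : nat) (l : seq eqcoord) : seq eqcoord :=
  take j l ++ drop j.+1 l.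

Definition wedge (alpha : covector R) (omega : dform R) : dform R := fun l =>
  \sum_(j < size l) (-1) ^+ j * alpha (nth ct l j) * omega (del j l).

Definition ext_d (omega : dform R) : dform R := fun l =>
  \sum_(j < size l) (-1) ^+ j * partial (nth ct l j) (omega (del j l)).

(* (L_V omega)_(a_1..a_k) = V (omega_(a_1..a_k))
     + \sum_j \sum_b (d V^b / d z_(a_j)) omega_(a_1..b..a_k), b in position j *)
Definition lie (V : eqcoord -> fn R eqcoord) (omega : dform R) : dform R := fun l =>
  vfield_act V (omega l) +
  \sum_(j < size l) \sum_(b \in [set: eqcoord])
    partial (nth ct l j) (V b) * omega (set_nth ct l j b).

Definition dcoord (a : eqcoord) : covector R := fun b => (b == a)%:R.
Definition dt : covector R := dcoord ct.
Definition dx : covector R := dcoord cx.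

Definition theta (K : fn R eqcoord) (i : nat) : covector R := fun b =>
  dcoord (cu i) b - iter i X K * dt b - coordfn (cu i.+1) * dx b.

Definition d_H (K : fn R eqcoord) (omega : dform R) : dform R :=
  wedge dx (lie Xfield omega) + wedge dt (lie (Tfield K) omega).

Definition d_V (K : fn R eqcoord) (omega : dform R) : dform R :=
  ext_d omega - d_H K omega.

Definition monomial_form (K : fn R eqcoord) (f : fn R eqcoord)
    (h : seq bool) (v : seq nat) : dform R :=
  foldr wedge (zeroform f) ([seq dcoord (inl b) | b <- h] ++ map (theta K) v).

Definition Omega (K : fn R eqcoord) (r s : nat) : set (dform R) :=
  [set omega | exists (m : nat) (f : 'I_m -> fn R eqcoord)
      (h : 'I_m -> r.-tuple bool) (v : 'I_m -> s.-tuple nat),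
    (forall j, smooth (f j)) /\
    omega = \sum_(j < m) monomial_form K (f j) (h j) (v j)].

Definition exact_forms (K : fn R eqcoord) (r s : nat) : set (dform R) :=
  if r is r'.+1 then d_H K @` Omega K r' s else [set 0].

(* the elements of the quotient H^(r,s), as cosets *)
Definition cohomology (K : fn R eqcoord) (r s : nat) : set (set (dform R)) :=
  [set c | exists2 omega : dform R, Omega K r s omega /\ d_H K omega = 0 &
    c = [set omega + beta | beta in exact_forms K r s]].

End EquationManifold.

Section JetSpace.
Context {R : realType}.

Definition ju (a i : nat) : jetcoord := inr (a, i).

Definition Dtfield (c : jetcoord) : fn R jetcoord :=
  match c with
  | inl b => b%:R
  | inr p => coordfn (ju p.1.+1 p.2)
  end.

Definition Dxfield (c : jetcoord) : fn R jetcoord :=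
  match c with
  | inl b => (~~ b)%:R
  | inr p => coordfn (ju p.1 p.2.+1)
  end.

Definition D_t : fn R jetcoord -> fn R jetcoord := vfield_act Dtfield.
Definition D_x : fn R jetcoord -> fn R jetcoord := vfield_act Dxfield.

(* a function of (t,x,u,u_1,..) regarded as a function on the jet space *)
Definition jet (f : fn R eqcoord) : fn R jetcoord := fun z =>
  f (fun c => match c with inl b => z (inl b) | inr i => z (ju 0 i) end).

Definition Euler (L : fn R jetcoord) : fn R jetcoord :=
  \sum_(p \in [set: nat * nat])
    (-1) ^+ (p.1 + p.2) * iter p.2 D_x (iter p.1 D_t (partial (ju p.1 p.2) L)).

Definition frechet (Q : fn R eqcoord) (f : fn R jetcoord) : fn R jetcoord :=
  \sum_(i \in [set: nat]) jet (partial (cu i) Q) * iter i D_x f.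

Definition frechet_adj (Q : fn R eqcoord) (f : fn R jetcoord) : fn R jetcoord :=
  \sum_(i \in [set: nat])
    iter i (fun g => - D_x g) (jet (partial (cu i) Q) * f).

Definition Delta (K : fn R eqcoord) : fn R jetcoord :=
  coordfn (ju 1 0) - jet K.

Definition is_Dx_operator (E : fn R jetcoord -> fn R jetcoord) : Prop :=
  exists (m : nat) (r : nat -> fn R eqcoord),
    (forall i, smooth (r i)) /\
    forall f, smooth f -> E f = \sum_(i < m) jet (r i) * iter i D_x f.

Definition variational_operator (D : fn R jetcoord)
    (E : fn R jetcoord -> fn R jetcoord) : Prop :=
  is_Dx_operator E /\ exists L' : fn R jetcoord, smooth L' /\ E D = Euler L'.

End JetSpace.

(* Main.v *)
Require Import Defs.
From HB Require Import structures.
From mathcomp Require Import all_boot all_order all_algebra.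
From mathcomp Require Import ring zify.
From mathcomp Require Import all_classical all_reals all_analysis.

Set Implicit Arguments.
Unset Strict Implicit.
Unset Printing Implicit Defensive.

Import Order.TTheory GRing.Theory Num.Theory.
Import numFieldNormedType.Exports.

Local Open Scope classical_set_scope.
Local Open Scope ring_scope.

(** The equation d_H eta = d_V lambda becomes concrete once both sides are
    evaluated on the coordinate vector fields d/dt, d/dx, d/du_i.  With
    gamma_i the coefficient of theta^i in gamma it reads, for every i,

      dL/du_i = X(gamma_i) + gamma_(i-1) + [i = 0] T(Q) + Q dK/du_i

    (lemma [determining_equations]).  Two facts then give the theorem.

    Applying (-X)^i and summing over i, the terms containing gamma telescope,
    because (-X)^i X(gamma_i) = - (-X)^(i+1) gamma_i cancels
    (-X)^(i+1) gamma_i; all the theta-coefficients of gamma beyond a certain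
    order vanish, and what remains is

      sum_i (-X)^i (dL/du_i - Q dK/du_i) = T(Q)

    ([telescoping_sum], [frechet_diff_DeltaE]).  On the other hand
    Q Delta = Q u_t - Q K depends on no derivative of u that involves t, except
    linearly on u_t, so the Euler operator can be written down explicitly
    ([Euler_source]):

      E(Q Delta + L) = - D_t Q + F_Q^*(Delta)
                       + sum_i (-D_x)^i (dL/du_i - Q dK/du_i).

    On the jet space T(Q) and D_t(Q) are different functions: T replaces
    u_(1,i) by X^i(K), and u_(1,i) - X^i(K) = D_x^i(Delta), whence
    D_t Q = T(Q) + F_Q(Delta) ([D_t_jet]).  Substituting both relations yields
    E(Q Delta + L) = F_Q^*(Delta) - F_Q(Delta).

    The analytic content is that smooth functions form a ring stable under
    partial derivatives, on which vector fields act as derivations.  That F_Q^*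
    is a differential operator with coefficients on the equation manifold is
    the Leibniz rule, applied repeatedly ([Dx_normal_form_mD_x]). *)

(** * Sums with finite support *)

Lemma fsum_seq (I : choiceType) (V : nmodType) (s : seq I) (F : I -> V) :
  uniq s -> (forall i, i \notin s -> F i = 0) ->
  \sum_(i \in [set: I]) F i = \sum_(i <- s) F i.
Proof.
move=> us F0; rewrite (fsbigE s) //; last by move=> i _; exact: F0.
by apply: eq_bigl => i; rewrite in_setT.
Qed.

Lemma fsum_nat (N : nat) (V : nmodType) (u : nat -> V) :
  (forall i, (N <= i)%N -> u i = 0) ->
  \sum_(i \in [set: nat]) u i = \sum_(i < N) u i.
Proof.
move=> u0; rewrite (@fsum_seq _ _ (iota 0 N)) ?iota_uniq//.
  by rewrite -{1}[N]subn0 big_mkord.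
by move=> i; rewrite mem_iota leq0n add0n /= -leqNgt; exact: u0.
Qed.

Lemma fsum1 (I : choiceType) (W : nmodType) (i : I) (F : I -> W) :
  (forall j, j != i -> F j = 0) -> \sum_(j \in [set: I]) F j = F i.
Proof.
move=> F0; rewrite (@fsum_seq _ _ [:: i]) ?big_seq1// => j.
by rewrite inE; exact: F0.
Qed.

Lemma fsum0 (I : choiceType) (W : nmodType) (F : I -> W) :
  (forall j, F j = 0) -> \sum_(j \in [set: I]) F j = 0.
Proof. by move=> F0; rewrite (@fsum_seq _ _ [::]) ?big_nil. Qed.

(** * Smooth functions and vector fields *)

Lemma reindex_continuous (R : realType) (C D : choiceType) (h : C -> D) :
  continuous ((fun z c => z (h c)) :
    prod_topology (fun _ : D => R) -> prod_topology (fun _ : C => R)).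
Proof.
move=> z.
have FF : Filter (nbhs (z : prod_topology (fun _ : D => R))).
  exact: nbhs_filter.
have H := cvg_sup
  (fun c => Topological.class (initial_topology (fun f : (C -> R) => f c))).
apply: (H _ _ _).2 => c U.
move=> [B] [[W] oW <-] Wz BU.
apply: filterS BU _; apply: (@proj_continuous D (fun=> R) (h c) z).
exact: open_nbhs_nbhs (conj oW Wz).
Qed.

Section PartialDerivatives.
Context {R : realType} {C : choiceType}.
Local Notation fn := (fn R C).
Local Notation space := (prod_topology (fun _ : C => R)).
Implicit Types (f g : fn) (a b : C) (z : C -> R).

Definition partially_derivable f : Prop :=
  forall a z, derivable (slice a f z) (z a) 1.

Definition finitely_many_coords f : Prop :=
  exists s : seq C, forall z z' : C -> R, {in s, z =1 z'} -> f z = f z'.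

Lemma slice_at a f z : slice a f z (z a) = f z.
Proof.
rewrite /slice; congr f; apply/funext => b /=.
by case: eqP => [->|].
Qed.

Lemma partial_cst a (r : R) : partial a (fun _ => r) = 0.
Proof. by apply/funext => z; rewrite /partial derive1E derive_cst. Qed.

Lemma partialD a f g : partially_derivable f -> partially_derivable g ->
  partial a (f + g) = partial a f + partial a g.
Proof.
move=> df dg; apply/funext => z; rewrite /partial derive1E.
by rewrite (_ : slice a (f + g) z = slice a f z + slice a g z) // deriveD //
  ?fctE -!derive1E.
Qed.

Lemma partialM a f g : partially_derivable f -> partially_derivable g ->
  partial a (f * g) = partial a f * g + f * partial a g.
Proof.
move=> df dg; apply/funext => z; rewrite /partial derive1E.
rewrite (_ : slice a (f * g) z = slice a f z * slice a g z) // deriveM //.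
by rewrite !slice_at /= -!derive1E addrC mulrC.
Qed.

Lemma slice_coordfn a b z :
  slice a (coordfn b) z = if b == a then id else cst (z b).
Proof. by rewrite /slice /coordfn /=; apply/funext => s; case: eqP. Qed.

Lemma partial_coordfn a b : partial a (coordfn b : fn) = (b == a)%:R.
Proof.
apply/funext => z; rewrite /partial derive1E slice_coordfn.
by case: eqP => _; rewrite ?derive_id ?derive_cst.
Qed.

Lemma partial_indep a f :
  (forall z s, f [eta z with a |-> s] = f z) -> partial a f = 0.
Proof.
move=> fa; apply/funext => z; rewrite /partial.
have -> : slice a f z = cst (f z) by apply/funext => s; exact: fa.
by rewrite derive1E derive_cst.
Qed.

Lemma partial_finite_support f : finitely_many_coords f ->
  exists s : seq C, forall a, a \notin s -> partial a f = 0.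
Proof.
move=> [s fs]; exists s => a as_; apply: partial_indep => z r.
apply: fs => b bs.
by rewrite /=; case: eqP => // ba; rewrite -ba bs in as_.
Qed.

Lemma smooth_derivable f : smooth f -> partially_derivable f.
Proof. by move=> [_ /(_ [::])[]]. Qed.

Lemma smooth_coords f : smooth f -> finitely_many_coords f.
Proof. by case. Qed.

Lemma smooth_continuous f : smooth f -> continuous (f : space -> R).
Proof. by move=> [_ /(_ [::])[]]. Qed.

Lemma smooth_partial a f : smooth f -> smooth (partial a f).
Proof.
move=> [[s fs] Hf]; split; last first.
  by move=> l; have := Hf (rcons l a); rewrite foldr_rcons.
exists (a :: s) => z z' zz'; rewrite /partial zz' ?mem_head //; congr derive1.
apply/funext => r; apply: fs => b bs /=; case: eqP => // _.
by apply: zz'; rewrite inE bs orbT.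
Qed.

(** Smoothness quantifies over all iterated partial derivatives, so it can be
    proved by coinduction: no formula for the iterated derivatives of a sum or
    a product is ever needed. *)
Lemma smooth_coind (S : fn -> Prop) :
  (forall f, S f -> [/\ finitely_many_coords f, continuous (f : space -> R),
     partially_derivable f & forall a, S (partial a f)]) ->
  forall f, S f -> smooth f.
Proof.
move=> HS f Sf; split; first by case: (HS _ Sf).
move=> l; have /HS[_ cf df _] : S (foldr partial f l) by
  elim: l => //= a l /HS[].
by [].
Qed.

(** The partial derivatives of a product are sums of products, so products
    alone are not a coinductive invariant, but the ring generated by the smooth
    functions, the constants and the coordinates is one. *)
Inductive ring_closure : fn -> Prop :=
| rc_smooth f : smooth f -> ring_closure f
| rc_cst r : ring_closure (fun _ => r)
| rc_coord a : ring_closure (coordfn a)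
| rc_add f g : ring_closure f -> ring_closure g -> ring_closure (f + g)
| rc_mul f g : ring_closure f -> ring_closure g -> ring_closure (f * g).

Lemma finitely_many_coords_op (op : R -> R -> R) f g :
  finitely_many_coords f -> finitely_many_coords g ->
  finitely_many_coords (fun z => op (f z) (g z)).
Proof.
move=> [s fs] [s' gs]; exists (s ++ s') => z z' zz'.
by congr op; [apply: fs|apply: gs] => b bs; apply: zz'; rewrite mem_cat bs ?orbT.
Qed.

Lemma ring_closure_smooth f : ring_closure f -> smooth f.
Proof.
move: f; apply: smooth_coind => f; elim=> {f}.
- move=> f sf; split; [exact: smooth_coords|exact: smooth_continuous| |].
    exact: smooth_derivable.
  by move=> a; apply/rc_smooth/smooth_partial.
- move=> r; split.
  + by exists [::].
  + exact: (@cst_continuous space R r).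
  + by move=> a z; exact: derivable_cst.
  + by move=> a; rewrite partial_cst; exact: rc_cst.
- move=> b; split.
  + by exists [:: b] => z z'; apply; exact: mem_head.
  + exact: (@proj_continuous C (fun=> R) b).
  + move=> a z; rewrite slice_coordfn.
    by case: eqP => _; [exact: derivable_id|exact: derivable_cst].
  + by move=> a; rewrite partial_coordfn; case: eqP => _; exact: rc_cst.
- move=> f g rf [fcf cf df pf] rg [fcg cg dg pg]; split.
  + exact: finitely_many_coords_op.
  + by move=> z; exact: (cvgD (cf z) (cg z)).
  + by move=> a z; exact: (derivableD (df a z) (dg a z)).
  + by move=> a; rewrite partialD//; exact: rc_add.
- move=> f g rf [fcf cf df pf] rg [fcg cg dg pg]; split.
  + exact: finitely_many_coords_op.
  + by move=> z; exact: (cvgM (cf z) (cg z)).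
  + by move=> a z; exact: (derivableM (df a z) (dg a z)).
  + by move=> a; rewrite partialM//; apply: rc_add; exact: rc_mul.
Qed.

Lemma smooth_cst r : smooth ((fun _ => r) : fn).
Proof. exact/ring_closure_smooth/rc_cst. Qed.

Lemma smooth0 : smooth (0 : fn). Proof. exact: smooth_cst. Qed.

Lemma smooth1 : smooth (1 : fn). Proof. exact: smooth_cst. Qed.

Lemma smooth_coordfn a : smooth (coordfn a : fn).
Proof. exact/ring_closure_smooth/rc_coord. Qed.

Lemma smoothD f g : smooth f -> smooth g -> smooth (f + g).
Proof. by move=> sf sg; apply/ring_closure_smooth/rc_add; exact: rc_smooth. Qed.

Lemma smoothM f g : smooth f -> smooth g -> smooth (f * g).
Proof. by move=> sf sg; apply/ring_closure_smooth/rc_mul; exact: rc_smooth. Qed.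

Lemma smoothN f : smooth f -> smooth (- f).
Proof. by rewrite -mulN1r; apply: smoothM; exact: (smooth_cst (-1)). Qed.

Lemma smoothB f g : smooth f -> smooth g -> smooth (f - g).
Proof. by move=> sf sg; apply: smoothD => //; exact: smoothN. Qed.

Lemma smooth_nat k : smooth (k%:R : fn).
Proof.
elim: k => [|k IH]; first exact: smooth0.
by rewrite mulrS; apply: smoothD => //; exact: smooth1.
Qed.

Lemma smooth_sum (I : eqType) (s : seq I) (F : I -> fn) :
  (forall i, i \in s -> smooth (F i)) -> smooth (\sum_(i <- s) F i).
Proof.
move=> sF; rewrite big_seq; elim/big_ind: _ => //; first exact: smooth0.
exact: smoothD.
Qed.

Lemma smooth_partialD a f g : smooth f -> smooth g ->
  partial a (f + g) = partial a f + partial a g.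
Proof. by move=> sf sg; apply: partialD; exact: smooth_derivable. Qed.

Lemma smooth_partialM a f g : smooth f -> smooth g ->
  partial a (f * g) = partial a f * g + f * partial a g.
Proof. by move=> sf sg; apply: partialM; exact: smooth_derivable. Qed.

Lemma smooth_partialN a f : smooth f -> partial a (- f) = - partial a f.
Proof.
move=> sf; apply/eqP; rewrite -addr_eq0 -smooth_partialD ?addNr; last exact: sf.
  by rewrite partial_cst.
exact: smoothN.
Qed.

Section VectorFields.
Variable V : C -> fn.

Lemma vfield_act_seq f (s : seq C) : uniq s ->
  (forall a, a \notin s -> V a * partial a f = 0) ->
  vfield_act V f = \sum_(a <- s) V a * partial a f.
Proof. exact: fsum_seq. Qed.

(** A vector field acts by a sum whose range depends on the function; a range
    common to several functions is what makes termwise computation possible. *)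
Lemma vfield_act_common_support (fs : seq fn) : (forall f, f \in fs -> smooth f) ->
  exists s : seq C, forall f, f \in fs ->
  vfield_act V f = \sum_(a <- s) V a * partial a f.
Proof.
move=> sfs.
have [s Hs] : exists s : seq C,
    forall f a, f \in fs -> a \notin s -> partial a f = 0.
  elim: fs sfs => [|f fs IH] sfs; first by exists [::].
  have [|s Hs] := IH; first by move=> g gfs; apply: sfs; rewrite inE gfs orbT.
  have [|s' Hs'] := @partial_finite_support f.
    by apply/smooth_coords/sfs/mem_head.
  exists (s' ++ s) => g a; rewrite inE mem_cat negb_or => /orP[/eqP->|gfs].
    by case/andP=> /Hs'.
  by case/andP=> _; exact: Hs.
exists (undup s) => f ffs; apply: vfield_act_seq; first exact: undup_uniq.
by move=> a; rewrite mem_undup => /(Hs _ _ ffs)->; rewrite mulr0.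
Qed.

Lemma vfield_actD f g : smooth f -> smooth g ->
  vfield_act V (f + g) = vfield_act V f + vfield_act V g.
Proof.
move=> sf sg; have [|s Hs] := @vfield_act_common_support [:: f; g; f + g].
  move=> h; rewrite !inE => /or3P[] /eqP-> //; exact: smoothD.
rewrite !Hs ?inE ?eqxx ?orbT// -big_split /=; apply: eq_bigr => a _.
by rewrite smooth_partialD// mulrDr.
Qed.

Lemma vfield_actM f g : smooth f -> smooth g ->
  vfield_act V (f * g) = vfield_act V f * g + f * vfield_act V g.
Proof.
move=> sf sg; have [|s Hs] := @vfield_act_common_support [:: f; g; f * g].
  move=> h; rewrite !inE => /or3P[] /eqP-> //; exact: smoothM.
rewrite !Hs ?inE ?eqxx ?orbT// mulr_suml mulr_sumr -big_split /=.
apply: eq_bigr => a _; rewrite smooth_partialM//; ring.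
Qed.

Lemma vfield_act_cst (r : R) : vfield_act V (fun _ => r) = 0.
Proof.
rewrite (@vfield_act_seq _ [::]) ?big_nil// => a _.
by rewrite partial_cst mulr0.
Qed.

Lemma vfield_act0 : vfield_act V 0 = 0. Proof. exact: vfield_act_cst. Qed.

Lemma vfield_actN f : smooth f -> vfield_act V (- f) = - vfield_act V f.
Proof.
move=> sf; apply/eqP; rewrite -addr_eq0 -vfield_actD ?addNr ?vfield_act0//.
exact: smoothN.
Qed.

Lemma vfield_actB f g : smooth f -> smooth g ->
  vfield_act V (f - g) = vfield_act V f - vfield_act V g.
Proof. by move=> sf sg; rewrite vfield_actD ?vfield_actN//; exact: smoothN. Qed.

Lemma vfield_act_sum (I : eqType) (s : seq I) (F : I -> fn) :
  (forall i, i \in s -> smooth (F i)) ->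
  vfield_act V (\sum_(i <- s) F i) = \sum_(i <- s) vfield_act V (F i).
Proof.
elim: s => [|i s IH] sF; first by rewrite !big_nil vfield_act0.
have sF' j : j \in s -> smooth (F j).
  by move=> js; apply: sF; rewrite inE js orbT.
rewrite !big_cons vfield_actD ?IH //; first exact/sF/mem_head.
exact: smooth_sum.
Qed.

Lemma smooth_vfield_act f : (forall a, smooth (V a)) -> smooth f ->
  smooth (vfield_act V f).
Proof.
move=> sV sf; have [|s ->] := @vfield_act_common_support [:: f];
  last exact: mem_head.
  by move=> h; rewrite inE => /eqP->.
apply: smooth_sum => a _; apply: smoothM => //; exact: smooth_partial.
Qed.

Lemma vfield_act_coordfn a : vfield_act V (coordfn a) = V a.
Proof.
rewrite (@vfield_act_seq _ [:: a]) ?big_seq1 ?partial_coordfn ?eqxx ?mulr1//.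
by move=> b; rewrite inE partial_coordfn eq_sym => /negbTE->; rewrite mulr0.
Qed.

End VectorFields.
End PartialDerivatives.

(** * The equation manifold inside the jet space *)

Section Jets.
Context {R : realType}.
Implicit Types (f g : fn R eqcoord) (F G : fn R jetcoord).

Definition eqcoords_upto (N : nat) : seq eqcoord :=
  ct :: cx :: [seq cu i | i <- iota 0 N].

Lemma uniq_eqcoords_upto N : uniq (eqcoords_upto N).
Proof.
rewrite /eqcoords_upto /= inE /= map_inj_uniq ?iota_uniq; last by move=> i j [].
by rewrite andbT; apply/andP; split; apply/mapP => -[].
Qed.

Definition shifted (g : nat -> fn R eqcoord) (i : nat) : fn R eqcoord :=
  if i is j.+1 then g j else 0.

Lemma smooth_shifted (g : nat -> fn R eqcoord) i :
  (forall j, smooth (g j)) -> smooth (shifted g i).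
Proof. by case: i => [|i] sg; [exact: smooth0|exact: sg]. Qed.

Definition order_bound (N : nat) f : Prop :=
  forall i, (N <= i)%N -> partial (cu i) f = 0.

Lemma smooth_order_bound f : smooth f ->
  exists N0, forall N, (N0 <= N)%N -> order_bound N f.
Proof.
move=> /smooth_coords/partial_finite_support[s fs].
(* the bound exceeds every index i for which u_i is among the variables *)
exists (\max_(c <- s) (if c is inr i then i.+1 else 0)%N) => N sN i Ni.
apply: fs; apply/negP => is_; have := leq_trans sN Ni.
by rewrite leqNgt (big_rem _ is_) /= leq_maxl.
Qed.

Lemma notin_eqcoords_upto N c : c \notin eqcoords_upto N ->
  exists2 i, c = cu i & (N <= i)%N.
Proof.
case: c => [[]|i] //; rewrite !inE /= => ciN; exists i => //.
rewrite leqNgt; apply: contra ciN => iN.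
by apply/mapP; exists i => //; rewrite mem_iota.
Qed.

Lemma vfield_actE V f N : order_bound N f ->
  vfield_act V f = V ct * partial ct f + V cx * partial cx f +
    \sum_(i < N) V (cu i) * partial (cu i) f.
Proof.
move=> fN; rewrite (@vfield_act_seq _ _ _ _ (eqcoords_upto N)).
- by rewrite !big_cons big_map -{1}[N]subn0 big_mkord addrA.
- exact: uniq_eqcoords_upto.
- by move=> c /notin_eqcoords_upto[i -> /fN->]; rewrite mulr0.
Qed.

Definition eq_to_jet (c : eqcoord) : jetcoord :=
  match c with inl b => inl b | inr i => ju 0 i end.

Lemma eq_to_jet_inj : injective eq_to_jet.
Proof. by move=> [b|i] [b'|i'] //= [->]. Qed.

Lemma jetE f z : jet f z = f (z \o eq_to_jet).
Proof. by rewrite /jet; congr f; apply/funext => -[]. Qed.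

Lemma jetD f g : jet (f + g) = jet f + jet g. Proof. by []. Qed.
Lemma jetN f : jet (- f) = - jet f. Proof. by []. Qed.
Lemma jetM f g : jet (f * g) = jet f * jet g. Proof. by []. Qed.
Lemma jet0 : jet (0 : fn R eqcoord) = 0. Proof. by []. Qed.
Lemma jet_sum (I : Type) (s : seq I) (F : I -> fn R eqcoord) :
  jet (\sum_(i <- s) F i) = \sum_(i <- s) jet (F i).
Proof. exact: (big_morph _ jetD jet0). Qed.

Lemma slice_jet c f z :
  slice (eq_to_jet c) (jet f) z = slice c f (z \o eq_to_jet).
Proof.
apply/funext => s; rewrite /slice jetE; congr f; apply/funext => b /=.
by rewrite (inj_eq eq_to_jet_inj).
Qed.

Lemma partial_jet c f : partial (eq_to_jet c) (jet f) = jet (partial c f).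
Proof. by apply/funext => z; rewrite jetE /partial slice_jet. Qed.

Lemma partial_jet_out c f : (forall b, eq_to_jet b != c) ->
  partial c (jet f) = 0.
Proof.
move=> cb; apply: partial_indep => z s; rewrite !jetE; congr f.
by apply/funext => b /=; rewrite (negbTE (cb b)).
Qed.

Lemma eq_to_jetP c : (exists b, c = eq_to_jet b) \/ (forall b, eq_to_jet b != c).
Proof.
case: c => [b|[[|a] i]]; first by left; exists (inl b).
  by left; exists (cu i).
by right; case.
Qed.

Lemma continuous_jet f :
  continuous (f : prod_topology (fun _ : eqcoord => R) -> R) ->
  continuous (jet f : prod_topology (fun _ : jetcoord => R) -> R).
Proof.
move=> cf z.
rewrite (_ : jet f = f \o (fun z => z \o eq_to_jet)); last first.
  by apply/funext => w; rewrite jetE.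
exact: (@continuous_comp (prod_topology (fun _ : jetcoord => R))
  (prod_topology (fun _ : eqcoord => R)) R (fun z => z \o eq_to_jet) f z
  (@reindex_continuous R _ _ eq_to_jet z) (cf _)).
Qed.

Lemma smooth_jet f : smooth f -> smooth (jet f).
Proof.
move=> sf.
apply: (@smooth_coind _ _ (fun F => exists2 f, smooth f & F = jet f));
  last by exists f.
move=> _ {f sf} [f sf ->]; split.
- have [s fs] := smooth_coords sf; exists (map eq_to_jet s) => z z' zz'.
  by rewrite !jetE; apply: fs => c cs; apply: zz'; rewrite map_f.
- exact/continuous_jet/smooth_continuous.
- move=> c z; case: (eq_to_jetP c) => [[b ->]|cb].
    by rewrite slice_jet; exact: smooth_derivable.
  rewrite (_ : slice c (jet f) z = cst (jet f z)); first exact: derivable_cst.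
  apply/funext => s; rewrite /slice !jetE; congr f.
  by apply/funext => b /=; rewrite (negbTE (cb b)).
- move=> c; case: (eq_to_jetP c) => [[b ->]|cb].
    by exists (partial b f); [exact: smooth_partial|rewrite partial_jet].
  by exists 0; [exact: smooth0|rewrite partial_jet_out].
Qed.

Lemma vfield_act_jet V f N : order_bound N f ->
  vfield_act V (jet f) =
    V (inl true) * jet (partial ct f) + V (inl false) * jet (partial cx f) +
    \sum_(i < N) V (ju 0 i) * jet (partial (cu i) f).
Proof.
move=> fN; rewrite (@vfield_act_seq _ _ _ _ (map eq_to_jet (eqcoords_upto N))).
- rewrite !big_map !big_cons big_map -{1}[N]subn0 big_mkord addrA !partial_jet.
  by congr +%R; apply: eq_bigr => i _; rewrite partial_jet.
- by rewrite map_inj_uniq ?uniq_eqcoords_upto//; exact: eq_to_jet_inj.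
- move=> c; case: (eq_to_jetP c) => [[b ->]|cb _]; last first.
    by rewrite partial_jet_out ?mulr0.
  rewrite mem_map; last exact: eq_to_jet_inj.
  by move=> /notin_eqcoords_upto[i -> /fN fi]; rewrite partial_jet fi jet0 mulr0.
Qed.

(** X and D_x have the same components in the directions t, x, u_i, the only
    ones that a function on the equation manifold sees. *)
Lemma D_x_jet f : smooth f -> D_x (jet f) = jet (X f).
Proof.
move=> /smooth_order_bound[N /(_ _ (leqnn N)) fN].
rewrite /D_x /X (vfield_act_jet _ fN) (vfield_actE _ fN).
by rewrite !jetD !jetM jet_sum; congr +%R.
Qed.

Lemma smooth_Xfield c : smooth (Xfield c : fn R eqcoord).
Proof. by case: c => [b|i]; [exact: smooth_nat|exact: smooth_coordfn]. Qed.

Lemma smooth_X f : smooth f -> smooth (X f).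
Proof. by apply: smooth_vfield_act; exact: smooth_Xfield. Qed.

Lemma smooth_iter_X i f : smooth f -> smooth (iter i X f).
Proof. by move=> sf; elim: i => //= i; exact: smooth_X. Qed.

Lemma smooth_Tfield K c : smooth K -> smooth (Tfield K c : fn R eqcoord).
Proof. by case: c => [b|i] sK; [exact: smooth_nat|exact: smooth_iter_X]. Qed.

Lemma smooth_Dxfield c : smooth (Dxfield c : fn R jetcoord).
Proof. by case: c => [b|i]; [exact: smooth_nat|exact: smooth_coordfn]. Qed.

Lemma smooth_D_x F : smooth F -> smooth (D_x F).
Proof. by apply: smooth_vfield_act; exact: smooth_Dxfield. Qed.

Lemma smooth_iter_D_x i F : smooth F -> smooth (iter i D_x F).
Proof. by move=> sF; elim: i => //= i; exact: smooth_D_x. Qed.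

Lemma iter_D_x_jet i f : smooth f -> iter i D_x (jet f) = jet (iter i X f).
Proof.
by move=> sf; elim: i => //= i ->; rewrite D_x_jet//; exact: smooth_iter_X.
Qed.

Lemma iter_D_x_coordfn i a j :
  iter i D_x (coordfn (ju a j)) = (coordfn (ju a (i + j)) : fn R jetcoord).
Proof. by elim: i => //= i ->; rewrite /D_x vfield_act_coordfn. Qed.

Lemma iter_D_xB i F G : smooth F -> smooth G ->
  iter i D_x (F - G) = iter i D_x F - iter i D_x G.
Proof.
move=> sF sG; elim: i => //= i ->.
by rewrite /D_x vfield_actB //; exact: smooth_iter_D_x.
Qed.

Definition mD_x F : fn R jetcoord := - D_x F.

Lemma smooth_iter_mD_x i F : smooth F -> smooth (iter i mD_x F).
Proof. by move=> sF; elim: i => //= i IH; apply/smoothN/smooth_D_x. Qed.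

Lemma iter_mD_x0 i : iter i mD_x 0 = 0.
Proof. by elim: i => //= i ->; rewrite /mD_x /D_x vfield_act0 oppr0. Qed.

Lemma iter_mD_xD i F G : smooth F -> smooth G ->
  iter i mD_x (F + G) = iter i mD_x F + iter i mD_x G.
Proof.
move=> sF sG; elim: i => //= i ->.
by rewrite /mD_x /D_x vfield_actD ?opprD//; exact: smooth_iter_mD_x.
Qed.

Lemma iter_mD_xE i F : smooth F -> iter i mD_x F = (-1) ^+ i * iter i D_x F.
Proof.
move=> sF; elim: i => [|i /= ->]; first by rewrite expr0 mul1r.
rewrite exprS mulN1r mulNr; congr (- _).
have sDF := smooth_iter_D_x i sF.
elim: i {F sF} (iter i D_x F) sDF => [|i IH] F sF; first by rewrite expr0 !mul1r.
rewrite exprSr -!mulrA !mulN1r IH; last exact: smoothN.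
by rewrite /D_x vfield_actN.
Qed.

(** [is_Dx_operator] fixes the number of coefficients; allowing any larger
    number, with zero coefficients, lets operators of different orders be
    added. *)
Definition Dx_normal_form (E : fn R jetcoord -> fn R jetcoord) : Prop :=
  exists (m : nat) (r : nat -> fn R eqcoord),
    [/\ forall i, smooth (r i), forall i, (m <= i)%N -> r i = 0 &
     forall F, smooth F -> forall M, (m <= M)%N ->
       E F = \sum_(i < M) jet (r i) * iter i D_x F].

Lemma Dx_normal_form_operator E : Dx_normal_form E -> is_Dx_operator E.
Proof. by move=> [m [r [sr _ Er]]]; exists m, r; split=> // F sF; exact: Er. Qed.

Lemma Dx_normal_form_eq E E' : (forall F, smooth F -> E F = E' F) ->
  Dx_normal_form E -> Dx_normal_form E'.
Proof.
move=> EE' [m [r [sr r0 Er]]]; exists m, r; split=> // F sF M mM.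
by rewrite -EE'// (Er _ _ M).
Qed.

Lemma Dx_normal_form_mul q : smooth q -> Dx_normal_form (fun F => jet q * F).
Proof.
move=> sq; exists 1%N, (fun i => if i is 0%N then q else 0); split.
- by case=> // i; exact: smooth0.
- by case.
- move=> F sF [|M] // _; rewrite big_ord_recl big1 ?addr0// => i _.
  by rewrite /= jet0 mul0r.
Qed.

Lemma Dx_normal_formD E E' : Dx_normal_form E -> Dx_normal_form E' ->
  Dx_normal_form (fun F => E F + E' F).
Proof.
move=> [m [r [sr r0 Er]]] [m' [r' [sr' r0' Er']]].
exists (maxn m m'), (fun i => r i + r' i); split.
- by move=> i; exact: smoothD.
- by move=> i; rewrite geq_max => /andP[mi mi']; rewrite r0// r0'// addr0.
- move=> F sF M; rewrite geq_max => /andP[mM mM'].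
  rewrite (Er _ _ M)// (Er' _ _ M)// -big_split; apply: eq_bigr => i _.
  by rewrite jetD mulrDl.
Qed.

(** By the Leibniz rule, D_x (r D_x^i F) = X(r) D_x^i F + r D_x^(i+1) F. *)
Lemma Dx_normal_form_mD_x E : Dx_normal_form E ->
  Dx_normal_form (fun F => mD_x (E F)).
Proof.
move=> [m [r [sr r0 Er]]].
(* the coefficients of - D_x o E, read off from the Leibniz rule *)
exists m.+1, (fun i => - (X (r i) + shifted r i)); split.
- move=> i; apply/smoothN/smoothD; first exact: smooth_X.
  exact: smooth_shifted.
- case=> // i mi; rewrite /= (r0 i)// (r0 i.+1) ?(ltnW mi)//.
  by rewrite /X vfield_act0 addr0 oppr0.
- move=> F sF [|M] // mM; rewrite (Er _ _ M.+1) ?(ltnW mM)//.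
  have sF' i : smooth (iter i D_x F) by exact: smooth_iter_D_x.
  rewrite /mD_x /D_x vfield_act_sum -/D_x; last first.
    by move=> i _; apply: smoothM => //; exact: smooth_jet.
  transitivity (- (\sum_(i < M.+1) jet (X (r i)) * iter i D_x F +
                   \sum_(i < M.+1) jet (r i) * iter i.+1 D_x F)).
    rewrite -big_split; congr (- _); apply: eq_bigr => i _ /=.
    by rewrite /D_x vfield_actM -/D_x ?D_x_jet//; exact: smooth_jet.
  rewrite [X in _ + X]big_ord_recr /= (r0 M)// jet0 mul0r addr0.
  under [RHS]eq_bigr do rewrite jetN jetD mulNr mulrDl.
  rewrite sumrN big_split /=; congr (- (_ + _)).
  by rewrite [RHS]big_ord_recl /= jet0 mul0r add0r.
Qed.

Lemma Dx_normal_form_iter i E : Dx_normal_form E ->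
  Dx_normal_form (fun F => iter i mD_x (E F)).
Proof. by move=> HE; elim: i => //= i; exact: Dx_normal_form_mD_x. Qed.

Lemma Dx_normal_form0 : Dx_normal_form (fun=> 0).
Proof.
exists 0%N, (fun=> 0); split=> // [_|F _ M _]; first exact: smooth0.
by rewrite big1// => i _; rewrite jet0 mul0r.
Qed.

Lemma Dx_normal_form_sum N (E : nat -> fn R jetcoord -> fn R jetcoord) :
  (forall i, Dx_normal_form (E i)) ->
  Dx_normal_form (fun F => \sum_(i < N) E i F).
Proof.
move=> HE; elim: N => [|N IH].
  by apply: Dx_normal_form_eq Dx_normal_form0 => F _; rewrite big_ord0.
apply: Dx_normal_form_eq (Dx_normal_formD IH (HE N)) => F _.
by rewrite big_ord_recr.
Qed.

Lemma frechetE Q F N : order_bound N Q ->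
  frechet Q F = \sum_(i < N) jet (partial (cu i) Q) * iter i D_x F.
Proof. by move=> QN; apply: fsum_nat => i /QN->; rewrite jet0 mul0r. Qed.

Lemma frechet_adjE Q F N : order_bound N Q ->
  frechet_adj Q F = \sum_(i < N) iter i mD_x (jet (partial (cu i) Q) * F).
Proof.
move=> QN; apply: fsum_nat => i /QN->.
by rewrite jet0 mul0r; exact: iter_mD_x0.
Qed.

(** F_Q^* is given in divergence form, with the coefficients inside the
    derivatives; moving them outside gives the required form. *)
Lemma frechet_diff_operator Q : smooth Q ->
  is_Dx_operator (fun F => frechet_adj Q F - frechet Q F).
Proof.
move=> sQ; have [N /(_ _ (leqnn N)) QN] := smooth_order_bound sQ.
apply: Dx_normal_form_operator.
apply: (@Dx_normal_form_eq (fun F =>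
  \sum_(i < N) iter i mD_x (jet (partial (cu i) Q) * F) +
  \sum_(i < N) jet (- partial (cu i) Q) * iter i D_x F)).
  move=> F _; rewrite (frechet_adjE _ QN) (frechetE _ QN) -sumrN; congr +%R.
  by apply: eq_bigr => i _; rewrite jetN mulNr.
apply: Dx_normal_formD.
  apply: (@Dx_normal_form_sum N
    (fun i F => iter i mD_x (jet (partial (cu i) Q) * F))) => i.
  by apply: Dx_normal_form_iter; apply: Dx_normal_form_mul; exact: smooth_partial.
exists N, (fun i => - partial (cu i) Q); split.
- by move=> i; apply: smoothN; exact: smooth_partial.
- by move=> i /QN->; rewrite oppr0.
- move=> F _ M NM.
  rewrite -!(big_mkord xpredT
    (fun i => jet (- partial (cu i) Q) * iter i D_x F)).
  rewrite (@big_cat_nat _ _ _ N 0 M) //= [X in _ = _ + X]big_nat_cond.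
  rewrite [X in _ = _ + X]big1 ?addr0// => i.
  by rewrite andbT => /andP[Ni _]; rewrite QN// oppr0 jet0 mul0r.
Qed.

End Jets.

(** * The equation satisfied by eta and lambda, in coordinates *)

Section Forms.
Context {R : realType}.
Implicit Types (f g K Q L : fn R eqcoord) (omega : dform R) (al : covector R)
  (a b c : eqcoord).

Lemma formB omega omega' l : (omega - omega') l = omega l - omega' l.
Proof. by []. Qed.
Lemma formD omega omega' l : (omega + omega') l = omega l + omega' l.
Proof. by []. Qed.

Lemma wedge1 al omega a : wedge al omega [:: a] = al a * omega [::].
Proof. by rewrite /wedge big_ord_recl big_ord0 /= addr0 expr0 mul1r. Qed.

Lemma wedge2 al omega a b :
  wedge al omega [:: a; b] = al a * omega [:: b] - al b * omega [:: a].
Proof.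
rewrite /wedge !big_ord_recl big_ord0 /= addr0 expr0 mul1r.
by rewrite expr1 mulN1r mulNr.
Qed.

Lemma wedge3 al omega a b c : wedge al omega [:: a; b; c] =
  al a * omega [:: b; c] - al b * omega [:: a; c] + al c * omega [:: a; b].
Proof.
rewrite /wedge !big_ord_recl big_ord0 /= addr0 expr0 mul1r.
by rewrite expr1 mulN1r mulNr sqrrN expr1n mul1r addrA.
Qed.

Lemma ext_d3 omega a b c : ext_d omega [:: a; b; c] =
  partial a (omega [:: b; c]) - partial b (omega [:: a; c]) +
  partial c (omega [:: a; b]).
Proof.
rewrite /ext_d !big_ord_recl big_ord0 /= addr0 expr0 mul1r.
by rewrite expr1 mulN1r sqrrN expr1n mul1r addrA.
Qed.

Lemma lie2 V omega a b : lie V omega [:: a; b] =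
  vfield_act V (omega [:: a; b]) +
  (\sum_(c \in [set: eqcoord]) partial a (V c) * omega [:: c; b] +
   \sum_(c \in [set: eqcoord]) partial b (V c) * omega [:: a; c]).
Proof. by rewrite /lie !big_ord_recl big_ord0 /= addr0. Qed.

Lemma dt_ct : (dt : covector R) ct = 1. Proof. by []. Qed.
Lemma dt_cx : (dt : covector R) cx = 0. Proof. by []. Qed.
Lemma dt_cu i : (dt : covector R) (cu i) = 0. Proof. by []. Qed.
Lemma dx_ct : (dx : covector R) ct = 0. Proof. by []. Qed.
Lemma dx_cx : (dx : covector R) cx = 1. Proof. by []. Qed.
Lemma dx_cu i : (dx : covector R) (cu i) = 0. Proof. by []. Qed.
Definition dtxE := (dt_ct, dt_cx, dt_cu, dx_ct, dx_cx, dx_cu).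

Lemma theta_cu K i j : theta K i (cu j) = (j == i)%:R.
Proof. by rewrite /theta !dtxE !mulr0 !subr0 /dcoord. Qed.

Lemma partial_Xfield_base (b : bool) c :
  partial (inl b) (Xfield c : fn R eqcoord) = 0.
Proof.
case: c => [b'|i] /=; last by rewrite partial_coordfn.
by case: b'; exact: partial_cst.
Qed.

Lemma partial_Tfield_base K a (b : bool) : partial a (Tfield K (inl b)) = 0.
Proof.
by case: b; exact: partial_cst.
Qed.

Lemma fsum_Xfield_cu i (F : eqcoord -> fn R eqcoord) :
  \sum_(c \in [set: eqcoord]) partial (cu i) (Xfield c) * F c =
  shifted (F \o cu) i.
Proof.
have PX (c : eqcoord) : partial (cu i) (Xfield c : fn R eqcoord) =
    (if c is inr j then j.+1 == i else false)%:R.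
  by case: c => [[]|j] /=; rewrite ?partial_coordfn //; exact: partial_cst.
case: i PX => [|i] PX.
  by apply: fsum0 => -[b|j]; rewrite PX mul0r.
rewrite (@fsum1 _ _ (cu i)) ?PX /= ?eqxx ?mul1r// => c.
rewrite PX; case: c => [b|j] ji; first by rewrite mul0r.
by rewrite eqSS (_ : (j == i) = false) ?mul0r//; apply: contra_neqF ji => /eqP->.
Qed.

(** The factors dt and dx leave the Lie derivative along T on (d/dx, d/du_i) and
    the one along X on (d/dt, d/du_i).  The components X^k(K) of T depend on x,
    which brings in the values of omega on (d/du_k, d/du_i); the hypothesis
    removes them. *)
Lemma d_H3 K omega i : (forall k l, omega [:: cu k; cu l] = 0) ->
  d_H K omega [:: ct; cx; cu i] =
  T K (omega [:: cx; cu i]) +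
  \sum_(c \in [set: eqcoord]) partial (cu i) (Tfield K c) * omega [:: cx; c] -
  (X (omega [:: ct; cu i]) + shifted (fun j => omega [:: ct; cu j]) i).
Proof.
move=> om0; rewrite /d_H formD !wedge3 !dtxE !mul0r mul1r !mul1r.
rewrite !addr0 !subr0 sub0r !lie2 [RHS]addrC -/X -/(T K).
rewrite (@fsum_Xfield_cu i (fun c => omega [:: ct; c])).
congr (- (_ + _) + (_ + _)).
  by rewrite fsum0 ?add0r// => c; rewrite partial_Xfield_base mul0r.
rewrite [X in X + _]fsum0 ?add0r// => -[b|k]; last by rewrite om0 mulr0.
by rewrite partial_Tfield_base mul0r.
Qed.

(** Neither dt nor dx has a component along d/du_i, so the value of a form on
    (d/dt, d/dx, d/du_i) is the coefficient of dt /\ dx /\ theta^i.  For eta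
    the Lie derivative along X turns gamma_i theta^i into
    X(gamma_i) theta^i + gamma_i theta^(i+1), and the one along T turns
    Q theta^0 into T(Q) theta^0 + Q d_V K. *)
Lemma determining_equations K Q L (gamma eta lambda : dform R) :
  eta = wedge dx (wedge (theta K 0) (zeroform Q)) - wedge dt gamma ->
  lambda = wedge dt (wedge dx (zeroform L)) ->
  (forall i, smooth (gamma [:: cu i])) ->
  d_H K eta = d_V K lambda ->
  forall i, partial (cu i) L =
    X (gamma [:: cu i]) + shifted (fun j => gamma [:: cu j]) i +
    ((if i is 0 then T K Q else 0) + partial (cu i) K * Q).
Proof.
move=> etaE lambdaE sg eq_dH i.
have eta_uu k l : eta [:: cu k; cu l] = 0.
  by rewrite etaE formB !wedge2 !dtxE !mul0r !subr0.
have eta_tu k : eta [:: ct; cu k] = - gamma [:: cu k].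
  by rewrite etaE formB !wedge2 !dtxE !mul0r !mul1r !subr0 sub0r.
have eta_xu k : eta [:: cx; cu k] = (k == 0)%:R * Q.
  by rewrite etaE formB !wedge2 !dtxE !wedge1 !theta_cu !mul0r !mul1r !subr0.
have lambda_u c k : lambda [:: c; cu k] = 0.
  by rewrite lambdaE wedge2 !wedge1 !dtxE !mul0r mulr0 subr0.
have lambda_tx : lambda [:: ct; cx] = L.
  by rewrite lambdaE wedge2 !wedge1 !dtxE !mul0r !mul1r subr0.
have dHlambda : d_H K lambda [:: ct; cx; cu i] = 0.
  rewrite d_H3; last by move=> k l; exact: lambda_u.
  rewrite !lambda_u /X /T !vfield_act0 !add0r fsum0; last first.
    by move=> [b|k]; rewrite ?partial_Tfield_base ?lambda_u ?mul0r ?mulr0.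
  by case: i => [|j]; rewrite /shifted ?lambda_u oppr0 addr0.
have := congr1 (fun om => om [:: ct; cx; cu i]) eq_dH.
rewrite /d_V formB dHlambda subr0 ext_d3 !lambda_u lambda_tx d_H3 //.
rewrite (partial_cst ct 0) (partial_cst cx 0) subrr add0r => <-.
rewrite (@fsum1 _ _ (cu 0)); last first.
  case=> [b|k] k0; first by rewrite partial_Tfield_base mul0r.
  rewrite eta_xu (_ : (k == 0%N) = false) ?mul0r ?mulr0//.
  by apply: contra_neqF k0 => /eqP->.
rewrite !eta_xu eta_tu mul1r /X vfield_actN ?sg// -/X.
rewrite opprD opprK addrC; congr (_ + _ + (_ + _)).
  by case: i {dHlambda} => [|j]; rewrite /shifted ?oppr0 // eta_tu opprK.
by case: i {dHlambda} => [|j]; rewrite ?mul1r // mul0r /T vfield_act0.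
Qed.

(** The value on d/du_i is the coefficient of theta^i, because dt and dx
    vanish there. *)
Lemma vertical_one_form_coefs K gamma : Omega K 0 1 gamma ->
  (forall i, smooth (gamma [:: cu i])) /\
  exists N, forall i, (N <= i)%N -> gamma [:: cu i] = 0.
Proof.
move=> [m [f [h [v [sf ->]]]]].
have E i : (\sum_(j < m) monomial_form K (f j) (h j) (v j)) [:: cu i] =
    \sum_(j < m) (i == thead (v j))%:R * f j.
  rewrite fct_sumE; apply: eq_bigr => j _.
  rewrite (tuple0 (h j)); case/tupleP: (v j) => k t; rewrite (tuple0 t) theadE.
  by rewrite /monomial_form /= wedge1 theta_cu.
split=> [i|].
  by rewrite E; apply: smooth_sum => j _; apply: smoothM => //; exact: smooth_nat.
exists (\max_(j < m) (thead (v j)).+1) => i mi; rewrite E big1// => j _.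
rewrite (_ : (i == _) = false) ?mul0r//; apply/negbTE; rewrite neq_ltn.
by apply/orP; right; apply: leq_trans mi; exact: (leq_bigmax j).
Qed.

End Forms.

(** * The Euler operator of Q Delta + L *)

Section EulerOperator.
Context {R : realType}.
Implicit Types (f K Q L : fn R eqcoord) (F G : fn R jetcoord).

Lemma smooth_Delta K : smooth K -> smooth (Delta K).
Proof. by move=> sK; apply: smoothB; [exact: smooth_coordfn|exact: smooth_jet]. Qed.

Lemma partial_Delta K c : smooth K ->
  partial c (Delta K) = (ju 1 0 == c)%:R - partial c (jet K).
Proof.
move=> sK; have sjK := smooth_jet sK.
rewrite smooth_partialD ?smooth_partialN ?partial_coordfn//.
- exact: smooth_coordfn.
- exact: smoothN.
Qed.

(** T is D_t with u_(1,i) replaced by X^i(K); the difference of the two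
    substitutions is D_x^i(Delta), which produces the Frechet derivative. *)
Lemma D_t_jet K Q : smooth K -> smooth Q ->
  D_t (jet Q) = jet (T K Q) + frechet Q (Delta K).
Proof.
move=> sK sQ; have [N /(_ _ (leqnn N)) QN] := smooth_order_bound sQ.
rewrite (frechetE _ QN) /D_t /T (vfield_act_jet _ QN) (vfield_actE _ QN).
rewrite !jetD !jetM jet_sum -[RHS]addrA; congr (_ + _).
rewrite -big_split; apply: eq_bigr => i _ /=.
rewrite iter_D_xB; last by exact: smooth_jet.
  rewrite iter_D_x_coordfn addn0 iter_D_x_jet// jetM /=; ring.
exact: smooth_coordfn.
Qed.

(** When u_t is the only derivative of u involving t on which F depends, the
    double sum of the Euler operator reduces to the term of u_t and the terms
    of the u_i. *)
Lemma EulerE F N : smooth F ->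
  (forall p, p \notin (1%N, 0%N) :: [seq (0%N, i) | i <- iota 0 N] ->
     partial (ju p.1 p.2) F = 0) ->
  Euler F = - D_t (partial (ju 1 0) F) +
    \sum_(i < N) iter i mD_x (partial (ju 0 i) F).
Proof.
move=> sF F0; rewrite /Euler
  (@fsum_seq _ _ ((1%N, 0%N) :: [seq (0%N, i) | i <- iota 0 N])).
- rewrite big_cons big_map -{1}[N]subn0 big_mkord /= expr1 mulN1r.
  congr (_ + _); apply: eq_bigr => i _.
  by rewrite iter_mD_xE//; exact: smooth_partial.
- rewrite /= map_inj_uniq ?iota_uniq ?andbT; last by move=> i j [].
  by apply/mapP => -[].
- move=> p /F0->.
  have a0 : iter p.1 D_t 0 = 0 :> fn R jetcoord.
    by elim: p.1 => //= a ->; exact: vfield_act0.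
  have i0 : iter p.2 D_x 0 = 0 :> fn R jetcoord.
    by elim: p.2 => //= a ->; exact: vfield_act0.
  by rewrite a0 i0 mulr0.
Qed.

Lemma partial_jet_ut f a i : partial (ju a.+1 i) (jet f) = 0.
Proof. by apply: partial_jet_out => -[]. Qed.

(** The term - D_t Q comes from u_t, which occurs with coefficient Q; the
    derivatives of Q in Q Delta give F_Q^*(Delta), and those of - K and L
    give the sum. *)
Lemma Euler_source K Q L N : smooth K -> smooth Q -> smooth L ->
  order_bound N K -> order_bound N Q -> order_bound N L ->
  Euler (jet Q * Delta K + jet L) = - D_t (jet Q) + frechet_adj Q (Delta K) +
    \sum_(i < N) iter i mD_x (jet (partial (cu i) L - partial (cu i) K * Q)).
Proof.
move=> sK sQ sL KN QN LN.
have sD := smooth_Delta sK; have sjQ := smooth_jet sQ; have sjL := smooth_jet sL.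
have PF c : partial c (jet Q * Delta K + jet L) =
    partial c (jet Q) * Delta K +
    jet Q * ((ju 1 0 == c)%:R - partial c (jet K)) + partial c (jet L).
  rewrite smooth_partialD ?smooth_partialM ?partial_Delta//.
  exact: smoothM.
rewrite (@EulerE _ N).
- rewrite -addrA; congr (- D_t _ + _).
    by rewrite PF !partial_jet_ut eqxx mul0r add0r addr0 subr0 mulr1.
  rewrite (frechet_adjE _ QN) -big_split; apply: eq_bigr => i _ /=.
  have E : forall f, partial (ju 0 i) (jet f) = jet (partial (cu i) f).
    by move=> f; exact: (partial_jet (cu i)).
  rewrite -iter_mD_xD; last 2 first.
  + by apply: smoothM => //; apply: smooth_jet; exact: smooth_partial.
  + apply: smooth_jet; apply: smoothB; [|apply: smoothM => //];
      exact: smooth_partial.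
  congr (iter i mD_x _); rewrite PF !E (_ : (_ == _) = false)// jetD jetN jetM.
  rewrite mulr0n; ring.
- by apply: smoothD => //; exact: smoothM.
- move=> [[|a] i] /=.
    rewrite inE /= => iN; have {}iN : (N <= i)%N.
      rewrite leqNgt; apply: contra iN => iN.
      by apply/mapP; exists i => //; rewrite mem_iota.
    rewrite PF !(partial_jet (cu i)) KN// QN// LN// !jet0.
    by rewrite (_ : (_ == _) = false)// !(mul0r, subr0, mulr0, addr0).
  move=> ai; rewrite PF !partial_jet_ut (_ : (_ == _) = false).
    by rewrite !(mul0r, subr0, mulr0, addr0).
  by apply: contraNF ai => /eqP[-> ->]; rewrite inE eqxx.
Qed.

Lemma iter_mD_x_D_x i F : smooth F ->
  iter i mD_x (D_x F) = - iter i.+1 mD_x F.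
Proof.
move=> sF; have sDF := smooth_D_x sF.
apply/eqP; rewrite -addr_eq0 iterSr -iter_mD_xD//; last exact: smoothN.
by rewrite addrN iter_mD_x0.
Qed.

(** (-D_x)^i D_x(gamma_i) = - (-D_x)^(i+1) gamma_i is cancelled by the term
    gamma_i at the index i + 1, and only the last one survives. *)
Lemma telescoping_sum (g : nat -> fn R eqcoord) N : (forall i, smooth (g i)) ->
  \sum_(i < N.+1)
    iter i mD_x (jet (X (g i) + shifted g i)) =
  - iter N.+1 mD_x (jet (g N)).
Proof.
move=> sg; have sj i := smooth_jet (sg i).
elim: N => [|N IH].
  by rewrite big_ord_recl big_ord0 addr0 /= addr0 -D_x_jet// /mD_x opprK.
rewrite big_ord_recr {}IH /= jetD -D_x_jet// -!iterS.
rewrite iter_mD_xD //; last exact: smooth_D_x.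
by rewrite iter_mD_x_D_x // addrC addrK.
Qed.

(** Here g_i stands for the coefficient of theta^i in gamma; g_N = 0 is what
    makes the surviving end (-D_x)^(N+1) g_N of the telescoping sum vanish. *)
Lemma frechet_diff_DeltaE K Q L (g : nat -> fn R eqcoord) N :
  smooth K -> smooth Q -> smooth L -> (forall i, smooth (g i)) ->
  order_bound N.+1 K -> order_bound N.+1 Q -> order_bound N.+1 L -> g N = 0 ->
  (forall i, partial (cu i) L = X (g i) + shifted g i +
     ((if i is 0 then T K Q else 0) + partial (cu i) K * Q)) ->
  frechet_adj Q (Delta K) - frechet Q (Delta K) =
  Euler (jet Q * Delta K + jet L).
Proof.
move=> sK sQ sL sg KN QN LN gN Leq.
rewrite (Euler_source sK sQ sL KN QN LN) (D_t_jet sK sQ).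
have sT : smooth (T K Q) by apply: smooth_vfield_act => // c; exact: smooth_Tfield.
suff -> : \sum_(i < N.+1) iter i mD_x
    (jet (partial (cu i) L - partial (cu i) K * Q)) = jet (T K Q) by ring.
have sS i : smooth (X (g i) + shifted g i).
  by apply: smoothD; [exact: smooth_X|exact: smooth_shifted].
transitivity (\sum_(i < N.+1)
   (iter i mD_x (jet (X (g i) + shifted g i)) +
   iter i mD_x (jet (if val i is 0%N then T K Q else 0)))).
  apply: eq_bigr => i _; rewrite -iter_mD_xD; last 2 first.
  - exact: smooth_jet.
  - by apply: smooth_jet; case: (val i) => // _; exact: smooth0.
  by rewrite Leq addrA addrK.
rewrite big_split /= telescoping_sum// gN jet0 iter_mD_x0 oppr0 add0r.
rewrite big_ord_recl big1 ?addr0// => i _.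
exact: (iter_mD_x0 (lift ord0 i)).
Qed.

End EulerOperator.

(* d_V anticommutes with dt, so that d_V (- dt /\ gamma) = + dt /\ d_V gamma;
   omegaE and omega_eta are consistent with this sign. *)
Theorem theorem5p4 (R : realType) (n : nat) (K Q L : fn R eqcoord)
    (c : set (dform R)) (omega gamma eta lambda : dform R)
    (n_ge2 : (2 <= n)%N)
    (K_smooth : smooth K) (K_order : order_le n K)
    (K_sep : forall z : eqcoord -> R, partial (cu n) K z != 0)
    (Q_smooth : smooth Q) (L_smooth : smooth L)
    (gammaP : Omega K 0 1 gamma)
    (cP : cohomology K 1 2 c) (omega_c : c omega)
    (omegaE : omega = wedge dx (wedge (theta K 0) (d_V K (zeroform Q)))
                      + wedge dt (d_V K gamma))
    (etaE : eta = wedge dx (wedge (theta K 0) (zeroform Q)) - wedge dt gamma)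
    (omega_eta : omega = d_V K eta)
    (lambdaE : lambda = wedge dt (wedge dx (zeroform L)))
    (eta_lambda : d_H K eta = d_V K lambda) :
  let E := fun f : fn R jetcoord => frechet_adj Q f - frechet Q f in
  variational_operator (Delta K) E /\
  E (Delta K) = Euler (jet Q * Delta K + jet L).
Proof.
move=> E.
have EE : E (Delta K) = Euler (jet Q * Delta K + jet L).
  have [sg [Ng gN]] := vertical_one_form_coefs gammaP.
  have [NK KN] := smooth_order_bound K_smooth.
  have [NQ QN] := smooth_order_bound Q_smooth.
  have [NL LN] := smooth_order_bound L_smooth.
  pose N := (Ng + NK + NQ + NL)%N.
  apply: (@frechet_diff_DeltaE _ _ _ _ (fun i => gamma [:: cu i]) N) => //.
  - by apply: KN; rewrite /N; lia.
  - by apply: QN; rewrite /N; lia.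
  - by apply: LN; rewrite /N; lia.
  - by apply: gN; rewrite /N; lia.
  - exact: determining_equations etaE lambdaE sg eta_lambda.
split=> //; split; first exact: frechet_diff_operator.
exists (jet Q * Delta K + jet L); split=> //.
apply: smoothD; last exact: smooth_jet.
by apply: smoothM; [exact: smooth_jet|exact: smooth_Delta].
Qed.
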